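(* Let $(\hat X,\hat f)$ be a dynamic Lyapunov function compactification of a dynamical system $(X,f)$. Let $\hat{\mathcal L}$ denote the set of Lyapunov functions for $(\hat X,\hat f)$ and let $\mathcal L$ denote the set of restrictions to $X$ of the elements of $\hat{\mathcal L}$, i.e. $\mathcal L$ consists of the Lyapunov functions for $(X,f)$ which extend continuously to $\hat X$. (a) $\mathcal L$ determines the topology of $X$ if and only if $\mathcal G\hat f\cap\mathcal G\hat f^{-1}\subset 1_{\hat X}$. (b) If $\mathcal Gf$ is asymmetric, i.e. $\mathcal Gf\cap\mathcal Gf^{-1}=\emptyset$, or if $f$ is +proper and $\mathcal Gf\cap\mathcal Gf^{-1}\subset 1_X$, then $\mathcal G\hat f\cap\mathcal G\hat f^{-1}\subset 1_{\hat X}$.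
   Context: A space is a locally compact, $\sigma$-compact Hausdorff space. A relation $f$ on $X$ is a subset of $X\times X$; $f(A)=\{y:(x,y)\in f\text{ for some }x\in A\}$, $f^{-1}$ is the reverse relation, $1_X$ is the diagonal. $f$ is closed if closed in $X\times X$; +proper if closed and $f(A)$ is compact for all compact $A$. A dynamical system $(X,f)$ is a space with a closed relation. $\mathcal Gf$ is the smallest closed transitive relation on $X$ containing $f$; $\mathcal Gf^{-1}=(\mathcal Gf)^{-1}$. $\mathcal B(X)$ is the Banach algebra of bounded continuous real functions on $X$ with the sup norm. A proper compactification of $X$ is a compact Hausdorff $\hat X$ containing $X$ as a dense (hence open) topological subspace; it corresponds to the closed subalgebra of functions in $\mathcal B(X)$ extending continuously to $\hat X$, and every closed subalgebra (containing the constants) distinguishing points from closed sets arises from a unique (up to homeomorphism) such $\hat X$. $\hat f$ is the closure of $f$ in $\hat X\times\hat X$. $(\hat X,\hat f)$ is dynamic if it is proper and $\mathcal G\hat f\cap(X\times X)=\mathcal Gf$. A Lyapunov function for $(X,f)$ is $L\in\mathcal B(X)$ with $L(x)\le L(y)$ whenever $(x,y)\in f$. With $\le_L=\{(x,y):L(x)\le L(y)\}$, a set $\mathcal K$ of Lyapunov functions is sufficient if $1_X\cup\mathcal Gf=\bigcap_{L\in\mathcal K}\le_L$. A Lyapunov function compactification of $(X,f)$ is the compactification associated with the closed subalgebra generated by a sufficient set of Lyapunov functions together with the continuous functions of compact support. A set $\mathcal L\subset\mathcal B(X)$ determines the topology of $X$ if, whenever $\{x_i\}$ is a net in $X$ and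 $x\in X$ are such that $\{L(x_i)\}$ converges to $L(x)$ for all $L\in\mathcal L$, the net $\{x_i\}$ converges to $x$. *)

(* Defs.v *)
From HB Require Import structures.
From mathcomp Require Import all_boot all_order all_algebra.
From mathcomp Require Import all_classical all_reals all_analysis.
Import Order.TTheory GRing.Theory Num.Theory.
Import numFieldNormedType.Exports.

Set Implicit Arguments.
Unset Strict Implicit.
Unset Printing Implicit Defensive.

Local Open Scope classical_set_scope.
Local Open Scope ring_scope.

Section Relations.
Variable X : topologicalType.
Implicit Types (f g : set (X * X)) (A : set X).

Definition sigma_compact :=
  exists K : nat -> set X, (forall n, compact (K n)) /\ \bigcup_n K n = setT.

Definition is_space :=
  [/\ locally_compact [set: X], sigma_compact & hausdorff_space X].

Definition rel_image f A : set X := [set y | exists2 x, A x & f (x, y)].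

Definition plus_proper f :=
  closed f /\ forall A, compact A -> compact (rel_image f A).

Definition transitive_set g :=
  forall x y z, g (x, y) -> g (y, z) -> g (x, z).

Definition G_rel f : set (X * X) :=
  smallest (fun g => closed g /\ transitive_set g) f.

Definition dynamical_system f := is_space /\ closed f.

End Relations.

Section Functions.
Variables (R : realType) (X : topologicalType).
Implicit Types (f : set (X * X)) (u v L : X -> R) (A K : set (X -> R)).

Definition BC : set (X -> R) := [set u | continuous u /\ bounded_fun u].

Definition supnorm u : R := sup (range (fun x => `|u x|)).

(* Subalgebras are unital, as needed to correspond to compactifications when X is
   not compact; scalar multiplication is multiplication by a constant. *)
Definition closed_subalgebra A :=
  [/\ A `<=` BC,
      forall c : R, A (cst c),
      (forall u v, A u -> A v -> A (u \+ v)),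
      (forall u v, A u -> A v -> A (u \* v)) &
      forall u, BC u ->
        (forall e : R, 0 < e -> exists2 v, A v & supnorm (u \- v) < e) ->
        A u].

Definition Cc : set (X -> R) :=
  [set u | continuous u /\ compact (closure [set x | u x != 0])].

Definition lyapunov f : set (X -> R) :=
  [set L | BC L /\ forall x y, f (x, y) -> L x <= L y].

Definition le_rel L : set (X * X) := [set p | L p.1 <= L p.2].

Definition sufficient f K :=
  K `<=` lyapunov f /\ diagonal `|` G_rel f = \bigcap_(L in K) le_rel L.

Definition directed (I : Type) (le : I -> I -> Prop) :=
  [/\ exists i : I, True,
      forall i, le i i,
      forall i j k, le i j -> le j k -> le i k &
      forall i j, exists k, le i k /\ le j k].

Definition tails (I : Type) (le : I -> I -> Prop) : set_system I :=
  [set S | exists i0, forall i, le i0 i -> S i].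

(* Convergence of a net [x : I -> X] is convergence along its tails. *)
Definition determines_topology A :=
  forall (I : Type) (le : I -> I -> Prop) (x : I -> X) (a : X),
    directed le ->
    (forall L, A L -> (fun i => L (x i)) @ tails le --> L a) ->
    x @ tails le --> a.

End Functions.

(* A compactification is given by the inclusion map [i : X -> Xh]. *)
Section Compactifications.
Variables (R : realType) (X Xh : topologicalType) (i : X -> Xh).
Implicit Types (f : set (X * X)) (u : X -> R).

Definition topological_embedding :=
  injective i /\
  forall U : set X, open U <-> exists2 V : set Xh, open V & i @^-1` V = U.

Definition proper_compactification :=
  [/\ compact [set: Xh], hausdorff_space Xh,
      topological_embedding & dense (range i)].

Definition extends_continuously u :=
  exists2 uh : Xh -> R, continuous uh & uh \o i = u.

Definition hat_rel f : set (Xh * Xh) :=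
  closure [set (i p.1, i p.2) | p in f].

Definition dynamic_compactification f :=
  proper_compactification /\
  [set p : X * X | G_rel (hat_rel f) (i p.1, i p.2)] = G_rel f.

(* The subalgebra associated with Xh is that of the functions in BC X which
   extend continuously to Xh. *)
Definition lyapunov_compactification f :=
  proper_compactification /\
  exists2 K : set (X -> R), sufficient f K &
    [set u | BC u /\ extends_continuously u] =
    smallest (@closed_subalgebra R X) (K `|` @Cc R X).

Definition restricted_lyapunov f : set (X -> R) :=
  [set Lh \o i | Lh in @lyapunov R Xh (hat_rel f)].

(* Equivalently, the Lyapunov functions for f which extend continuously. *)
Lemma restricted_lyapunovE f : proper_compactification ->
  restricted_lyapunov f = [set L | lyapunov f L /\ extends_continuously L].
Proof.
move=> [cpt _ [_ emb] _]; apply/seteqP; split => [_ [Lh [[cL bL] mL] <-]|L].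
  have ci : continuous i.
    by apply/continuousP => V oV; apply/emb; exists V.
  split; last by exists Lh.
  split; last by move=> x y fxy; apply: mL; apply: subset_closure; exists (x, y).
  split; first by move=> x; apply: continuous_comp; [exact: ci|exact: cL].
  by case: bL => M [Mr LM]; exists M; split=> // t Mt x _; exact: LM.
move=> [[_ mL] [Lh cL Lhi]]; exists Lh => //; split.
  split=> //.
  have /compact_bounded : compact (Lh @` setT).
    by apply: continuous_compact => //; exact: continuous_subspaceT.
  by move=> [M [Mr LM]]; exists M; split=> // t Mt x _; apply: LM => //; exists x.
move=> x y; rewrite -subr_ge0.
have cd : continuous (fun p : Xh * Xh => Lh p.2 - Lh p.1).
  move=> p; apply: cvgB.
    by apply: (@continuous_comp _ _ _ snd Lh); [exact: cvg_snd|exact: cL].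
  by apply: (@continuous_comp _ _ _ fst Lh); [exact: cvg_fst|exact: cL].
have cl : closed [set p : Xh * Xh | 0 <= Lh p.2 - Lh p.1].
  exact: (closed_comp (fun p _ => cd p) (@closed_ge R 0)).
have sub : [set (i p.1, i p.2) | p in f] `<=`
    [set p : Xh * Xh | 0 <= Lh p.2 - Lh p.1].
  move=> _ [[a b] fab <-] /=; rewrite subr_ge0.
  by have := mL _ _ fab; rewrite -Lhi.
by rewrite /hat_rel closureE => /(_ _ (conj cl sub)).
Qed.

End Compactifications.

Arguments restricted_lyapunov R {X Xh} i f.

(* Main.v *)
(* Call points p, q of Xh equivalent if every Lyapunov function for hat f takes the
   same value at p and q; pairs in G (hat f) and its reverse are equivalent.
   Equivalent points outside X coincide: the functions whose extension agrees at
   both points form a closed subalgebra containing Cc and the sufficient set.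
   Equivalent points of X are related by G f in both directions, by sufficiency.
   The remaining case of a point p of X and a point q outside X rests on this:
   if {p, q} is a whole equivalence class and p <> q, then (p, q) is in hat f.
   Otherwise, near the class no step of hat f goes from p's side to q's side, so a
   Lyapunov function can be lowered near q relative to p.  This gives (a), and in
   (b) it contradicts the fact that a +proper f sends no point of X to infinity. *)
Require Import Defs.
From mathcomp Require Import all_boot all_order all_algebra.
From mathcomp Require Import all_classical all_reals all_analysis.
From mathcomp Require Import ring lra.
Import Order.TTheory GRing.Theory Num.Theory.
Import numFieldNormedType.Exports.
Local Open Scope classical_set_scope.

(** * Lyapunov functions on a compact space *)

Section CompactSystem.
Set Implicit Arguments.
Unset Strict Implicit.
Local Open Scope ring_scope.
Variables (R : realType) (T : topologicalType) (f : set (T * T)).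
Hypothesis cptT : compact [set: T].
Implicit Types (L B C : T -> R) (p q z : T).

Let cmax L B : continuous L -> continuous B ->
  continuous (fun x => Num.max (L x) (B x)).
Proof. by move=> cL cB x; exact: (@continuous_max R T L B x (cL x) (cB x)). Qed.

Let cmin L B : continuous L -> continuous B ->
  continuous (fun x => Num.min (L x) (B x)).
Proof. by move=> cL cB x; exact: (@continuous_min R T L B x (cL x) (cB x)). Qed.

Lemma compact_lyapunov L :
  continuous L -> (forall x y, f (x, y) -> L x <= L y) -> lyapunov f L.
Proof.
move=> cL mL; split=> //; split=> //.
have /compact_bounded : compact (L @` setT).
  by apply: continuous_compact => //; exact: continuous_subspaceT.
by move=> [M [Mr LM]]; exists M; split=> // t Mt x _; apply: LM => //; exists x.
Qed.

(** The relation [L x <= L y] is closed, transitive and contains [f], hence contains [G_rel f]. *)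
Lemma lyapunov_G_rel L x y : lyapunov f L -> G_rel f (x, y) -> L x <= L y.
Proof.
move=> [[cL _] mL] /(_ [set z : T * T | L z.1 <= L z.2]); apply.
split; last by move=> [a b]; exact: mL.
split; last by move=> a b c /=; exact: le_trans.
have cd : continuous (fun z : T * T => L z.2 - L z.1).
  move=> z; apply: cvgB.
    by apply: (@continuous_comp _ _ _ snd L); [exact: cvg_snd|exact: cL].
  by apply: (@continuous_comp _ _ _ fst L); [exact: cvg_fst|exact: cL].
have -> : [set z : T * T | L z.1 <= L z.2] =
    (fun z : T * T => L z.2 - L z.1) @^-1` [set x | 0 <= x].
  by apply/seteqP; split=> z /=; rewrite subr_ge0.
apply: (@preimage_closed (T * T)%type R); first by move=> z _; exact: cd.
exact: closed_ge.
Qed.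

Let clamp (t : R) := Num.max 0 (Num.min 1 t).

Let clamp_itv t : 0 <= clamp t <= 1.
Proof. by rewrite /clamp le_max lexx ge_max ler01 ge_min lexx. Qed.

Let lyapunov_clamp L a b : lyapunov f L -> 0 <= a ->
  lyapunov f (fun x => clamp (a * L x + b)).
Proof.
move=> [[cL _] mL] a0; apply: compact_lyapunov.
  apply: cmax; first by move=> x; exact: cvg_cst.
  apply: cmin => x; first exact: cvg_cst.
  apply: cvgD; last exact: cvg_cst.
  by apply: cvgM; [exact: cvg_cst|exact: cL].
move=> x y /mL Lxy; apply: le_max2 => //; apply: le_min2 => //.
by rewrite lerD2r ler_wpM2l.
Qed.

(* A barrier (B, C) is to satisfy B = 1 or C = 0 away from the class of p; one
   function does not suffice, as points may lie above or below the class. *)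
Let barrier p : set ((T -> R) * (T -> R)) := [set BC |
  [/\ lyapunov f BC.1 /\ lyapunov f BC.2,
      (forall x, 0 <= BC.1 x <= 1) /\ (forall x, 0 <= BC.2 x <= 1) &
      BC.1 p = 0 /\ BC.2 p = 1]].

(** An affine rescaling of [L], clamped to the unit interval, serves as [C] when [L z < L p] and as
    [B] when [L p < L z]; the other function is constant. *)
Let lyapunov_local_barrier p z L : lyapunov f L -> L z <> L p ->
  exists2 BC, barrier p BC &
    \forall x \near z, 1 <= BC.1 x \/ BC.2 x <= 0.
Proof.
move=> lL /eqP; have [[cL _] mL] := lL; rewrite neq_lt => /orP[Lzp|Lpz].
(* With this slope the rescaled function is 1 at [p] and already 0 at the level midway between [L z]
   and [L p], so its clamp vanishes near [z]. *)
- pose a := 2 / (L p - L z).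
  have d0 : 0 < L p - L z by rewrite subr_gt0.
  have a0 : 0 <= a by rewrite divr_ge0// ltW.
  exists (cst 0, fun x => clamp (a * L x + (1 - a * L p))).
    split.
    + split; last exact: lyapunov_clamp.
      by apply: compact_lyapunov => // x; exact: cvg_cst.
    + by split=> x //=; rewrite lexx ler01.
    + by split=> //=; rewrite addrCA subrr addr0 /clamp minxx; apply/max_idPr.
  have : L z < (L z + L p) / 2 by rewrite midf_lt.
  move=> Lz; have : \forall x \near z, L x < (L z + L p) / 2.
    exact: cL (lt_nbhsl Lz).
  apply: filterS => x /= Lx; right.
  rewrite /clamp ge_max lexx/= ge_min; apply/orP; right.
  have -> : a * L x + (1 - a * L p) = (2 * L x - (L z + L p)) / (L p - L z).
    by rewrite /a; field; rewrite gt_eqF.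
  by rewrite pmulr_lle0 ?invr_gt0//; lra.
- pose a := 2 / (L z - L p).
  have d0 : 0 < L z - L p by rewrite subr_gt0.
  have a0 : 0 <= a by rewrite divr_ge0// ltW.
  exists (fun x => clamp (a * L x + (- (a * L p))), cst 1).
    split.
    + split; first exact: lyapunov_clamp.
      by apply: compact_lyapunov => // x; exact: cvg_cst.
    + by split=> x //=; rewrite lexx ler01.
    + by split=> //=; rewrite subrr /clamp (min_idPr _)// maxxx.
  have : (L z + L p) / 2 < L z by rewrite [L z + _]addrC midf_lt.
  move=> Lz; have : \forall x \near z, (L z + L p) / 2 < L x.
    exact: cL (lt_nbhsr Lz).
  apply: filterS => x /= Lx; left.
  rewrite /clamp le_max le_min lexx /= orbC.
  have -> : a * L x + (- (a * L p)) = (2 * L x - 2 * L p) / (L z - L p).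
    by rewrite /a; field; rewrite gt_eqF.
  by rewrite ler_pdivlMr//; lra.
Qed.

Let barrier_join p B C B' C' : barrier p (B, C) -> barrier p (B', C') ->
  barrier p (B \max B', C \min C').
Proof.
move=> [/= [[[cB _] mB] [[cC _] mC]] [iB iC] [Bp Cp]].
move=> [/= [[[cB' _] mB'] [[cC' _] mC']] [iB' iC'] [Bp' Cp']]; split => /=.
- split; apply: compact_lyapunov => [x|x y fxy].
  + exact: cmax.
  + by rewrite le_max2 ?mB ?mB'.
  + exact: cmin.
  + by rewrite le_min2 ?mC ?mC'.
- split=> x; [have /andP[? ?] := iB x; have /andP[? ?] := iB' x
             |have /andP[? ?] := iC x; have /andP[? ?] := iC' x].
    by rewrite le_max ge_max; apply/andP; split; [apply/orP; left|apply/andP].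
  by rewrite le_min ge_min; apply/andP; split; [apply/andP|apply/orP; left].
- by rewrite Bp Bp' Cp Cp' maxxx minxx.
Qed.

Lemma lyapunov_barrier p (Z : set T) : compact Z ->
  (forall z, Z z -> exists2 L : T -> R, lyapunov f L & L z <> L p) ->
  exists B C : T -> R, [/\ lyapunov f B /\ lyapunov f C,
    (forall x, 0 <= B x <= 1) /\ (forall x, 0 <= C x <= 1),
    B p = 0 /\ C p = 1 & forall z, Z z -> B z = 1 \/ C z = 0].
Proof.
move=> cZ sepZ.
(* Barriers are directed by increasing B and decreasing C, so compactness yields
   one that works on all of Z. *)
pose F := filter_from (barrier p) (fun BC => [set BC' |
  barrier p BC' /\ forall x, BC.1 x <= BC'.1 x /\ BC'.2 x <= BC.2 x]).
have b01 : barrier p (cst 0, cst 1).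
  split=> //=; last by split=> x; rewrite lexx ler01.
  by split; apply: compact_lyapunov => // x; exact: cvg_cst.
have FF : ProperFilter F.
  apply: filter_from_proper; last first.
    by move=> BC bBC; exists BC; split.
  apply: filter_from_filter; first by exists (cst 0, cst 1).
  move=> [B C] [B' C'] b b'; exists (B \max B', C \min C').
    exact: barrier_join.
  move=> [B2 C2] [b2 le2]; split; split=> // x; have [/= ] := le2 x;
    by rewrite ge_max le_min => /andP[? ?] /andP[? ?].
have /compact_near_coveringP/(_ _ F
  (fun BC x => 1 <= BC.1 x \/ BC.2 x <= 0)) nZ := cZ.
have : \forall BC \near F, Z `<=` (fun x => 1 <= BC.1 x \/ BC.2 x <= 0).
  apply: nZ => z /sepZ[L lL Lzp].
  have [BC bBC nz] := lyapunov_local_barrier lL Lzp.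
  exists ([set x | 1 <= BC.1 x \/ BC.2 x <= 0], [set BC' |
      barrier p BC' /\ forall x, BC.1 x <= BC'.1 x /\ BC'.2 x <= BC.2 x]).
    by split=> //; exists BC.
  move=> [x BC'] /= [[h|h] [_ /(_ x)[h1 h2]]].
    by left; exact: le_trans h h1.
  by right; exact: le_trans h2 h.
move=> nF; have nb : F (barrier p) by exists (cst 0, cst 1) => // BC [].
have [[B C] [/= ZBC [lBC [iB iC] BCp]]] := filter_ex (filterI nF nb).
exists B, C; split=> // z /ZBC /= [h|h]; [left|right]; apply/eqP.
  by rewrite eq_le h andbT; case/andP: (iB z).
by rewrite eq_le h; case/andP: (iC z).
Qed.

Hypothesis hT : hausdorff_space T.

Lemma urysohn_points p q : p <> q ->
  exists2 g : T -> R, continuous g & g p = 1 /\ g q = 0.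
Proof.
move=> pq; have cl1 (x : T) : closed [set x].
  by apply: accessible_closed_set1; exact: hausdorff_accessible.
have /(@uniform_separatorP T R)[g [cg _ g0 g1]] : uniform_separator [set q] [set p].
  apply: (proj1 (@normal_separatorP R T) (compact_normal hT cptT)) => //.
  by rewrite -subset0 => x [/= ->] /esym.
exists g => //; split; [have := g1 (g p)|have := g0 (g q)]; apply.
  by exists p.
by exists q.
Qed.

(** If [(p, q)] were outside the closed relation, a whole rectangle around it would be, and a
    Lyapunov function with value 2 at [p] and 1 at [q] could be built. *)
Lemma lyapunov_class_pair p q : closed f -> p <> q ->
  (forall L, lyapunov f L -> L p = L q) ->
  (forall z, z <> p -> z <> q -> exists2 L : T -> R, lyapunov f L & L z <> L p) ->
  f (p, q).
Proof.
move=> cf pq Lpq sep; apply: contrapT => nf.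
have : nbhs (p, q) (~` f) by apply: open_nbhs_nbhs; split=> //; exact: closed_openC.
move=> [[P Q] [/= nP nQ] PQf].
have [g cg [gp gq]] := urysohn_points pq.
(* Scaled so that [h] exceeds every [hi] near [p] and is below every [lo] near [q]. *)
pose h x : R := 4 * g x - 1.
have ch : continuous h.
  move=> x; apply: cvgB; last exact: cvg_cst.
  by apply: cvgM; [exact: cvg_cst|exact: cg].
pose U := P^° `&` h @^-1` [set t | 2 < t].
pose V := Q^° `&` h @^-1` [set t | t < 0].
have oU : open U.
  apply: openI; first exact: open_interior.
  by apply: open_comp; [move=> ? _; exact: ch|exact: open_gt].
have oV : open V.
  apply: openI; first exact: open_interior.
  by apply: open_comp; [move=> ? _; exact: ch|exact: open_lt].
have cZ : compact (~` (U `|` V)).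
  by apply: (subclosed_compact _ cptT) => //; apply: open_closedC; exact: openU.
have Up : U p by split=> //=; rewrite /h gp; lra.
have Vq : V q by split=> //=; rewrite /h gq; lra.
have [z Zz|B [C [[lB lC] [iB iC] [Bp Cp] ZBC]]] := @lyapunov_barrier p _ cZ.
  by apply: sep => zE; apply: Zz; rewrite zE; [left|right].
have Bq : B q = 0 by rewrite -(Lpq B).
have Cq : C q = 1 by rewrite -(Lpq C).
(* Both bounds are nondecreasing in [B] and [C], and hi - lo = C (1 - B) vanishes
   off U `|` V; clamping [h] between them gives [hi] on [U] and [lo] on [V]. *)
pose lo x := B x + C x.
pose hi x := B x * (1 - C x) + 2 * C x.
pose L x := Num.max (lo x) (Num.min (hi x) (h x)).
have lohi x : lo x <= hi x.
  by rewrite /lo /hi; have /andP[? ?] := iB x; have /andP[? ?] := iC x; nra.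
have lomono x y : f (x, y) -> lo x <= lo y.
  by move=> fxy; apply: lerD; [exact: lB.2|exact: lC.2].
have himono x y : f (x, y) -> hi x <= hi y.
  move=> fxy; have := lB.2 _ _ fxy; have := lC.2 _ _ fxy; rewrite /hi.
  have /andP[? ?] := iB x; have /andP[? ?] := iC x.
  have /andP[? ?] := iB y; have /andP[? ?] := iC y.
  by nra.
have Llo x : lo x <= L x by rewrite le_max lexx.
have Lhi x : L x <= hi x by rewrite ge_max lohi ge_min lexx.
have out z : ~ U z -> ~ V z -> lo z = hi z.
  by move=> nU nV; rewrite /lo /hi; case: (ZBC z) => [[]//|->|->]; ring.
have LU x : U x -> L x = hi x.
  move=> [_ /= hx]; rewrite /L min_l ?max_r //.
  by rewrite /hi; have /andP[? ?] := iB x; have /andP[? ?] := iC x; nra.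
have LV x : V x -> L x = lo x.
  move=> [_ /= hx]; rewrite /L max_l // ge_min; apply/orP; right.
  by rewrite /lo; have /andP[? ?] := iB x; have /andP[? ?] := iC x; lra.
have lL : lyapunov f L.
  apply: compact_lyapunov.
    have [[cB _] _] := lB; have [[cC _] _] := lC.
    apply: cmax; first by move=> x; apply: cvgD; [exact: cB|exact: cC].
    apply: cmin => // x; apply: cvgD; apply: cvgM; first exact: cB.
    - by apply: cvgB; [exact: cvg_cst|exact: cC].
    - exact: cvg_cst.
    - exact: cC.
  move=> x y fxy.
  (* Monotonicity of [lo] and [hi], and their equality off [U] and [V], settle every case but [x] in
     [U] and [y] in [V]; that case is a step from [P] to [Q], which [f] lacks. *)
  have [Vx|nVx] := pselect (V x).
    by rewrite LV//; exact: le_trans (lomono _ _ fxy) (Llo y).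
  have [Uy|nUy] := pselect (U y).
    by rewrite (LU y)//; exact: le_trans (Lhi x) (himono _ _ fxy).
  have [Ux|nUx] := pselect (U x); last first.
    apply: le_trans (Lhi x) _; rewrite -(out x)//.
    exact: le_trans (lomono _ _ fxy) (Llo y).
  have [Vy|nVy] := pselect (V y); last first.
    apply: le_trans (Lhi x) (le_trans (himono _ _ fxy) _).
    by rewrite -(out y).
  have : (~` f) (x, y).
    apply: PQf; split=> /=; apply: interior_subset; first by case: Ux.
    by case: Vy.
  by [].
have := Lpq L lL; rewrite LU// LV// /lo /hi Bp Cp Bq Cq.
by lra.
Qed.

End CompactSystem.

(** * The closed transitive hull of a relation *)

Section Relations.
Set Implicit Arguments.
Unset Strict Implicit.
Variables (X : topologicalType) (f : set (X * X)).

Lemma sub_G_rel : f `<=` G_rel f.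
Proof. exact: sub_gen_smallest. Qed.

Lemma G_rel_trans : transitive_set (G_rel f).
Proof.
move=> x y z xy yz g [[cg tg] fg].
by apply: (tg _ y); [apply: xy|apply: yz].
Qed.

End Relations.

(** * Closed subalgebras of bounded continuous functions *)

Section ClosedSubalgebras.
Set Implicit Arguments.
Unset Strict Implicit.
Local Open Scope ring_scope.
Variables (R : realType) (X : topologicalType).
Implicit Types (u v : X -> R) (A : set (X -> R)).

(** [bounded_fun] makes every number above some threshold a bound; the shift by 1 passes strictly
    beyond that threshold. *)
Lemma bounded_fun_normP u :
  bounded_fun u <-> exists M, forall x, `|u x| <= M.
Proof.
split=> [[M [Mr uM]]|[M uM]].
  by exists (M + 1) => x; apply: uM => //; rewrite ltrDl.
exists M; split=> [|t Mt x _]; first exact: num_real.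
exact: le_trans (uM x) (ltW Mt).
Qed.

Lemma BC_closed_subalgebra : closed_subalgebra (@BC R X).
Proof.
split=> // [c|u v [cu /bounded_fun_normP[M uM]] [cv /bounded_fun_normP[N vN]]
            |u v [cu /bounded_fun_normP[M uM]] [cv /bounded_fun_normP[N vN]]].
- split; first by move=> x; exact: cvg_cst.
  by apply/bounded_fun_normP; exists `|c|.
- split; first by move=> x; apply: cvgD; [exact: cu|exact: cv].
  apply/bounded_fun_normP; exists (M + N) => x.
  by rewrite (le_trans (ler_normD _ _))// lerD.
- split; first by move=> x; apply: cvgM; [exact: cu|exact: cv].
  apply/bounded_fun_normP; exists (M * N) => x.
  by rewrite normrM ler_pM.
Qed.

(** The inclusion in [BC] makes [BC] itself one of the intersected algebras, which keeps the
    intersection inside [BC]. *)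
Lemma smallest_closed_subalgebra A : A `<=` @BC R X ->
  closed_subalgebra (smallest (@closed_subalgebra R X) A).
Proof.
move=> ABC; split.
- by move=> u; apply; split=> //; exact: BC_closed_subalgebra.
- by move=> c M [[_ cM _ _ _] _]; exact: cM.
- by move=> u v Au Av M AM; case: (AM) => [[_ _ DM _ _] _]; apply: DM; [apply: Au|apply: Av].
- by move=> u v Au Av M AM; case: (AM) => [[_ _ _ MM _] _]; apply: MM; [apply: Au|apply: Av].
- move=> u BCu lim M AM; case: (AM) => [[_ _ _ _ LM] _]; apply: LM => // e e0.
  by have [v Av uv] := lim e e0; exists v => //; exact: Av.
Qed.

Lemma le_supnorm u : BC u -> forall x, `|u x| <= supnorm u.
Proof.
move=> [_ /bounded_fun_normP[M uM]] x; apply: ub_le_sup; last by exists x.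
by exists M => _ [y _ <-].
Qed.

End ClosedSubalgebras.

(** * Topology of a proper compactification and continuous extensions *)

Section Compactification.
Set Implicit Arguments.
Unset Strict Implicit.
Local Open Scope ring_scope.
Variables (R : realType) (X Xh : topologicalType) (i : X -> Xh).
Hypothesis pc : proper_compactification i.
Implicit Types (f : set (X * X)) (L : Xh -> R).

Lemma compactification_continuous : continuous i.
Proof.
by have [_ _ [_ emb] _] := pc; apply/continuousP => V oV; apply/emb; exists V.
Qed.

Let ci := compactification_continuous.

Lemma compactification_dense (S : set Xh) :
  closed S -> (forall x, S (i x)) -> forall z, S z.
Proof.
have [_ _ _ di] := pc; move=> cS Si z; apply: contrapT => Sz.
have [y [Sy [x _ ixy]]] := di (~` S) (ex_intro _ z Sz) (closed_openC cS).
by apply: Sy; rewrite -ixy; exact: Si.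
Qed.

Lemma extension_le (L : Xh -> R) c :
  continuous L -> (forall x, L (i x) <= c) -> forall z, L z <= c.
Proof.
move=> cL; apply: (@compactification_dense (L @^-1` [set t | t <= c])).
apply: (@preimage_closed Xh R); last exact: closed_le.
by move=> z _; exact: cL.
Qed.

Lemma extension_unique (L M : Xh -> R) :
  continuous L -> continuous M -> L \o i = M \o i -> L = M.
Proof.
move=> cL cM LM.
have le (L1 L2 : Xh -> R) : continuous L1 -> continuous L2 ->
    L1 \o i = L2 \o i -> forall z, L1 z <= L2 z.
  move=> c1 c2 L12 z; rewrite -subr_le0; apply: (@extension_le (L1 \- L2)).
    by move=> x; apply: cvgB; [exact: c1|exact: c2].
  by move=> x; have /= -> := congr1 (@^~ x) L12; rewrite subrr.
by apply/funext => z; apply/eqP; rewrite eq_le !le.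
Qed.

(* A point outside X has a neighbourhood missing the image of the support. *)
Lemma Cc_extension_outside L p : continuous L -> Cc (L \o i) ->
  ~ range i p -> L p = 0.
Proof.
move=> cL [_ cK] ip; have [_ hT _ di] := pc.
set K := closure _ in cK.
have ciK : closed (i @` K).
  apply: compact_closed => //; apply: continuous_compact => //.
  exact: continuous_subspaceT.
have : (i @` K `|` L @^-1` [set 0]) p.
  apply: compactification_dense => [|x].
    apply: closedU => //; apply: (@preimage_closed Xh R); first by move=> z _; exact: cL.
    exact: closed_eq.
  have [Lx|Lx] := eqVneq (L (i x)) 0; first by right.
  by left; exists x => //; exact: subset_closure.
by case=> // -[x _ ixp]; case: ip; exists x.
Qed.

Lemma compact_nbhs_image (A : set X) a : nbhs a A -> compact A ->
  exists2 V : set Xh, nbhs (i a) V & V `<=` i @` A.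
Proof.
move=> nA cA; have [_ hT [inji emb] di] := pc.
have [V oV VA] := (emb A^°).1 (open_interior A).
exists V.
  apply: open_nbhs_nbhs; split=> //; have : (i @^-1` V) a by rewrite VA.
  by [].
have ciA : closed (i @` A).
  apply: compact_closed => //; apply: continuous_compact => //.
  exact: continuous_subspaceT.
have cl : closed (~` V `|` i @` A) by apply: closedU => //; exact: open_closedC.
move=> z Vz; case: (compactification_dense cl _ z) => // x.
have [Vx|nVx] := pselect (V (i x)); last by left.
right; exists x => //; apply: interior_subset.
by have : (i @^-1` V) x by []; rewrite VA.
Qed.

Lemma compactification_restriction_BC L : continuous L -> BC (L \o i).
Proof.
move=> cL; have [cT _ _ _] := pc; split.
  by move=> x; apply: continuous_comp; [exact: ci|exact: cL].
(* For the empty relation every continuous function is Lyapunov, so this only extracts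
   boundedness. *)
have [[_ /bounded_fun_normP[M LM]] _] :=
  @compact_lyapunov R Xh set0 cT L cL (fun _ _ => False_ind _).
by apply/bounded_fun_normP; exists M => x; exact: LM.
Qed.

Variable f : set (X * X).

(** Pairs of [f] close to [(i a, z)] start in a compact neighbourhood [A] of [a], so they end in the
    compact image of [A], which is closed in [Xh] and stays away from any [z] outside X. *)
Lemma plus_proper_hat_rel a z : is_space X -> plus_proper f ->
  hat_rel i f (i a, z) -> range i z.
Proof.
move=> [lcX _ hX] [cf pf] fh; have [_ hT _ _] := pc; apply: contrapT => iz.
have [A wA [cA _]] := lcX a I.
have nA : nbhs a A.
  have : \forall x \near a, setT x -> A x := wA.
  by apply: filterS => x; exact.
have [V nV VA] := compact_nbhs_image nA cA.
have cifA : closed (i @` rel_image f A).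
  apply: compact_closed => //; apply: continuous_compact; last exact: pf.
  exact: continuous_subspaceT.
have nW : nbhs z (~` (i @` rel_image f A)).
  apply: open_nbhs_nbhs; split; first exact: closed_openC.
  by move=> [x _ ixz]; apply: iz; exists x.
have nVW : nbhs (i a, z) (V `*` ~` (i @` rel_image f A)) by exists (V, ~` (i @` rel_image f A)).
have [_ [[[x y] fxy <-] [/= Vx Wy]]] := fh _ nVW.
apply: Wy; exists y => //; have [x' Ax' ixx'] := VA _ Vx.
have [_ _ [inji _] _] := pc.
by exists x => //; rewrite -(inji _ _ ixx').
Qed.

(** * Separation of points by Lyapunov functions *)

Hypothesis lc : lyapunov_compactification R i f.

Lemma lyapunov_separates_outside p q : ~ range i p -> ~ range i q ->
  (forall L, lyapunov (hat_rel i f) L -> L p = L q) -> p = q.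
Proof.
move=> ip iq Lpq; have [cT hT _ _] := pc; have [_ [K [Kl _] KE]] := lc.
pose S : set (X -> R) := [set u | BC u /\
  exists2 uh : Xh -> R, continuous uh & uh \o i = u /\ uh p = uh q].
have CcBC : @Cc R X `<=` @BC R X.
  move=> u [cu su]; split=> //; apply/bounded_fun_normP.
  have /compact_bounded : compact (u @` closure [set x | u x != 0]).
    by apply: continuous_compact => //; exact: continuous_subspaceT.
  (* The 0 bounds [u] off its support, since [M] may be negative when the support is empty. *)
  move=> [M [_ uM]]; exists (Num.max 0 (M + 1)) => x; rewrite le_max.
  have [->|ux] := eqVneq (u x) 0; first by rewrite normr0 lexx.
  by rewrite (uM (M + 1)) ?ltrDl ?orbT//; exists x => //; exact: subset_closure.
have KCBC : K `|` @Cc R X `<=` @BC R X.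
  by move=> u [/Kl []|/CcBC].
(* By [KE] the extendable functions form a closed subalgebra; [limA] thus extends uniform limits of
   extendable functions. *)
have := smallest_closed_subalgebra KCBC; rewrite -KE => -[_ _ _ _ limA].
have cS : closed_subalgebra S.
  split.
  - by move=> u [].
  - move=> c; have [_ BCc _ _ _] := @BC_closed_subalgebra R X.
    by split; [exact: BCc|exists (cst c) => // x; exact: cvg_cst].
  - have [_ _ BCD _ _] := @BC_closed_subalgebra R X.
    move=> u v [BCu [uh cu [uE upq]]] [BCv [vh cv [vE vpq]]]; split; first exact: BCD.
    exists (uh \+ vh); first by move=> x; apply: cvgD; [exact: cu|exact: cv].
    by split; [rewrite -uE -vE|rewrite /= upq vpq].
  - have [_ _ _ BCM _] := @BC_closed_subalgebra R X.
    move=> u v [BCu [uh cu [uE upq]]] [BCv [vh cv [vE vpq]]]; split; first exact: BCM.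
    exists (uh \* vh); first by move=> x; apply: cvgM; [exact: cu|exact: cv].
    by split; [rewrite -uE -vE|rewrite /= upq vpq].
  - move=> u BCu limu; have [_ [uh cu uE]] : [set u | BC u /\ extends_continuously i u] u.
      apply: limA => // e /limu[v [BCv [vh cv [vE _]]] uv].
      by exists v => //; split=> //; exists vh.
    split=> //; exists uh => //; split=> //; apply/eqP; rewrite -subr_eq0 -normr_le0.
    apply/ler_addgt0Pr => e e0; rewrite add0r.
    have [|v [BCv [vh cv [vE vpq]]] uv] := limu (e / 2); first by rewrite divr_gt0.
    (* The uniform estimate on X passes to [Xh] by density, and is then used at both [p] and [q]. *)
    have d z : `|uh z - vh z| <= e / 2.
      apply: (@extension_le (fun z => `|uh z - vh z|)).
        by move=> y; apply: cvg_norm; apply: cvgB; [exact: cu|exact: cv].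
      move=> x; apply: le_trans (ltW uv).
      have -> : uh (i x) - vh (i x) = (u \- v) x by rewrite -uE -vE.
      apply: le_supnorm.
      have -> : u \- v = (uh \- vh) \o i by rewrite -uE -vE.
      apply: compactification_restriction_BC.
      by move=> y; apply: cvgB; [exact: cu|exact: cv].
    have -> : uh p - uh q = (uh p - vh p) - (uh q - vh q) by rewrite vpq; ring.
    by rewrite (le_trans (ler_normB _ _))// [e]splitr lerD.
have AS : [set u | BC u /\ extends_continuously i u] `<=` S.
  rewrite KE; apply: smallest_sub => // u uKC.
  have [BCu [uh cu uE]] : [set u | BC u /\ extends_continuously i u] u.
    by rewrite KE; exact: sub_gen_smallest.
  split=> //; exists uh => //; split=> //; case: uKC => [/Kl lu|].
    have : restricted_lyapunov R i f u.
      by rewrite restricted_lyapunovE//; split=> //; exists uh.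
    move=> [Lh lLh LhE]; rewrite (@extension_unique uh Lh) ?uE//; first exact: Lpq.
    by case: lLh => -[].
  by rewrite -uE => uC; rewrite !(Cc_extension_outside cu uC).
apply: contrapT => pq.
(* The restriction of a continuous function separating [p] and [q] lies in [S], contradicting
   uniqueness of extensions. *)
have [g cg [gp gq]] := @urysohn_points R Xh cT hT p q pq.
have [_ [h ch [hE]]] : S (g \o i).
  apply: AS; split; first exact: compactification_restriction_BC.
  by exists g.
rewrite (extension_unique ch cg hE) gp gq => /eqP.
by rewrite oner_eq0.
Qed.

(** Members of the sufficient set extend to Lyapunov functions for [hat_rel i f], so they agree at
    [a] and [b]; sufficiency then applies to both [(a, b)] and [(b, a)]. *)
Lemma lyapunov_separates_inside a b :
  (forall L, lyapunov (hat_rel i f) L -> L (i a) = L (i b)) ->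
  a = b \/ G_rel f (a, b) /\ G_rel f (b, a).
Proof.
move=> Lab; have [_ [K [Kl Ksuff] KE]] := lc.
have Kab u : K u -> u a = u b.
  move=> Ku; have [BCu eu] : [set u | BC u /\ extends_continuously i u] u.
    by rewrite KE; apply: sub_gen_smallest; left.
  have : restricted_lyapunov R i f u.
    by rewrite restricted_lyapunovE//; split=> //; exact: Kl.
  by move=> [Lh lLh <-]; exact: Lab.
have : (diagonal `|` G_rel f) (a, b).
  by rewrite Ksuff => u Ku; rewrite /le_rel /= Kab.
have : (diagonal `|` G_rel f) (b, a).
  by rewrite Ksuff => u Ku; rewrite /le_rel /= Kab.
case=> [/= ba|ba]; first by left.
by case=> [/= ab|ab]; [left|right].
Qed.

End Compactification.

(** * Nets and determination of the topology *)

Lemma tails_proper_filter (I : Type) (le : I -> I -> Prop) :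
  directed le -> ProperFilter (tails le).
Proof.
move=> [[i0 _] lexx le_tr ubI]; split.
  by move=> [j jP]; exact: (jP j (lexx j)).
split; first by exists i0.
  move=> P Q [j jP] [k kQ]; have [l [jl kl]] := ubI j k.
  by exists l => m lm; split; [apply: jP; exact: le_tr lm|apply: kQ; exact: le_tr lm].
by move=> P Q PQ [j jP]; exists j => k /jP /PQ.
Qed.

Section DeterminesTopology.
Set Implicit Arguments.
Unset Strict Implicit.
Variables (R : realType) (X Xh : topologicalType) (i : X -> Xh).
Variable f : set (X * X).
Hypothesis pc : proper_compactification i.

(** Every cluster point in [Xh] of the image net has the Lyapunov values of [i a], so it is [i a].
    Compactness gives convergence to [i a], and the embedding brings it back to X. *)
Lemma separated_determines_topology :
  (forall a z, (forall L : Xh -> R, lyapunov (hat_rel i f) L -> L (i a) = L z) ->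
    z = i a) ->
  determines_topology (restricted_lyapunov R i f).
Proof.
move=> sep I le x a dir Lx; have [cT hT [_ emb] _] := pc.
have FF := @tails_proper_filter _ _ dir.
pose G := (i \o x) @ tails le.
have PG : ProperFilter G by exact: fmap_proper_filter.
have clG z : cluster G z -> z = i a.
  move=> Gz; apply: sep => L lL; have [[cL _] _] := lL.
  apply: (@Rhausdorff R) => P Q nP nQ.
  have GP : G (L @^-1` P).
    have : (fun j => L (i (x j))) @ tails le --> L (i a).
      by apply: (Lx (L \o i)); exists L.
    by move/(_ P nP).
  by have [y [Py Qy]] := Gz _ _ GP (cL z Q nQ); exists (L y).
have Ga : G --> i a.
  apply: (@compact_cluster_set1 Xh (i a) G setT) => //; first exact: filterT.
    exact: filterT.
  apply/seteqP; split=> [z /clG //|_ ->].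
  by have [z [_ Gz]] := cT G PG filterT; rewrite -(clG z Gz).
move=> U; rewrite /= nbhsE => -[W [oW Wa] WU].
have [V oV VW] := (emb W).1 oW.
have nV : nbhs (i a) V.
  by apply: open_nbhs_nbhs; split=> //; have : (i @^-1` V) a by rewrite VW.
have : tails le [set j | V (i (x j))] := Ga V nV.
apply: filterS => j Vj; apply: WU; rewrite -VW; exact: Vj.
Qed.

(** By density some net in X tends to [z]. Its Lyapunov values tend to those of [i a], so it also
    tends to [a], and limits in [Xh] are unique. *)
Lemma determines_topology_separated :
  determines_topology (restricted_lyapunov R i f) -> forall a z,
  (forall L : Xh -> R, lyapunov (hat_rel i f) L -> L (i a) = L z) -> z = i a.
Proof.
move=> det a z Laz; have [cT hT _ di] := pc.
(* Indices are neighbourhoods of [z] with a chosen point of X inside, ordered by reverse inclusion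
   of the neighbourhoods alone. *)
pose I := {w : set Xh * X | nbhs z w.1 /\ w.1 (i w.2)}.
pose le (w w' : I) := (sval w').1 `<=` (sval w).1.
pose x (w : I) := (sval w).2.
have exI (V : set Xh) : nbhs z V -> exists w : I, (sval w).1 = V.
  move=> nV; have [y [Vy [b _ iby]]] : V^° `&` range i !=set0.
    by apply: di; [exists z|exact: open_interior].
  suff H : nbhs z V /\ V (i b) by exists (exist _ (V, b) H).
  by split=> //; rewrite iby; exact: interior_subset.
have dir : directed le.
  split=> [|j|j k l jk kl|j k].
  - by have [w _] := exI setT filterT; exists w.
  - by [].
  - exact: subset_trans kl jk.
  - have [nj _] := svalP j; have [nk _] := svalP k.
    have [w wE] := exI _ (filterI nj nk); exists w.
    by rewrite /le wE; split=> y [].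
have FF := @tails_proper_filter _ _ dir.
have xz : (i \o x) @ tails le --> z.
  move=> V nV; have [w wE] := exI V nV; exists w => w'.
  by rewrite /le wE; apply; have [_] := svalP w'.
have xa : x @ tails le --> a.
  apply: det dir _ => _ [L lL <-]; have [[cL _] _] := lL.
  rewrite /= (Laz L lL).
  exact: (@cvg_comp _ _ _ (i \o x) L _ _ _ xz (cL z)).
have xia : (i \o x) @ tails le --> i a.
  by apply: cvg_comp xa _; exact: compactification_continuous.
exact: (cvg_unique hT xz xia).
Qed.

End DeterminesTopology.

(** * Equivalence classes joining a point of X to a point outside *)

Section LyapunovClasses.
Set Implicit Arguments.
Unset Strict Implicit.
Variables (R : realType) (X Xh : topologicalType) (i : X -> Xh).
Variable f : set (X * X).
Hypothesis lc : lyapunov_compactification R i f.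

(** The class is exactly [i a] and [q]: a member in X is [i a] by hypothesis, one outside X is [q]
    by separation. [lyapunov_class_pair] then applies in both orders. *)
Lemma lyapunov_class_at_infinity a q :
  (forall b, (forall L : Xh -> R, lyapunov (hat_rel i f) L -> L (i a) = L (i b)) ->
    b = a) ->
  ~ range i q ->
  (forall L : Xh -> R, lyapunov (hat_rel i f) L -> L (i a) = L q) ->
  hat_rel i f (i a, q) /\ hat_rel i f (q, i a).
Proof.
move=> inj iq Laq; have [pc _] := lc; have [cT hT _ _] := pc.
have aq : i a <> q by move=> aq; apply: iq; exists a.
have cf : closed (hat_rel i f) by exact: closed_closure.
have sep z : z <> i a -> z <> q ->
    exists2 L : Xh -> R, lyapunov (hat_rel i f) L & L z <> L (i a).
  move=> za zq; apply: contrapT => noL.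
  have Laz (L : Xh -> R) : lyapunov (hat_rel i f) L -> L (i a) = L z.
    by move=> lL; apply: contrapT => Lz; apply: noL; exists L => // /esym.
  have [[b _ bz]|iz] := pselect (range i z).
    by apply: za; rewrite -bz (inj b)// => L lL; rewrite bz Laz.
  apply: zq; apply: (lyapunov_separates_outside pc lc) => // L lL.
  by rewrite -Laz// Laq.
split; first exact: (lyapunov_class_pair cT hT cf aq Laq sep).
apply: (lyapunov_class_pair cT hT cf (not_eq_sym aq)) => [L lL|z zq za].
  exact: esym (Laq L lL).
by have [L lL Lz] := sep z za zq; exists L => //; rewrite -(Laq L lL).
Qed.

End LyapunovClasses.

Theorem theorem2p23 (R : realType) (X Xh : topologicalType)
    (f : set (X * X)) (i : X -> Xh) :
  dynamical_system f ->
  lyapunov_compactification R i f ->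
  dynamic_compactification i f ->
  (determines_topology (restricted_lyapunov R i f) <->
   G_rel (hat_rel i f) `&` (G_rel (hat_rel i f))^-1%relation `<=` diagonal) /\
  (G_rel f `&` (G_rel f)^-1%relation = set0 \/
   plus_proper f /\ G_rel f `&` (G_rel f)^-1%relation `<=` diagonal ->
   G_rel (hat_rel i f) `&` (G_rel (hat_rel i f))^-1%relation `<=` diagonal).
Proof.
move=> [sX _] lc [pc dyn]; have [cT hT [inji _] _] := pc.
have GE a b : G_rel (hat_rel i f) (i a, i b) = G_rel f (a, b) by rewrite -dyn.
have Gequiv p q : G_rel (hat_rel i f) (p, q) -> G_rel (hat_rel i f) (q, p) ->
    forall L : Xh -> R, lyapunov (hat_rel i f) L -> L p = L q.
  move=> pq qp L lL; apply/eqP.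
  by rewrite eq_le !(lyapunov_G_rel lL).
have sepout := lyapunov_separates_outside pc lc.
have sepin := lyapunov_separates_inside pc lc.
(* Two equivalent points outside X coincide, so by symmetry the first point may be taken in X. *)
have from_inside : (forall a q, G_rel (hat_rel i f) (i a, q) ->
      G_rel (hat_rel i f) (q, i a) -> i a = q) ->
    G_rel (hat_rel i f) `&` (G_rel (hat_rel i f))^-1%relation `<=` diagonal.
  move=> H [p q] [/= pq qp]; rewrite /diagonal /=.
  have [[a _ ap]|ip] := pselect (range i p).
    by rewrite -ap in pq qp *; exact: H.
  have [[b _ bq]|iq] := pselect (range i q).
    by rewrite -bq in pq qp *; apply/esym; exact: H.
  by apply: sepout => // L lL; exact: Gequiv lL.
split; first split.
- move=> det; apply: from_inside => a q aq qa.
  apply/esym; apply: (determines_topology_separated pc det) => L lL.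
  exact: Gequiv lL.
- move=> asym.
  have inj a b : (forall L : Xh -> R, lyapunov (hat_rel i f) L -> L (i a) = L (i b)) ->
      b = a.
    move=> Lab; have [->//|[ab ba]] := sepin a b Lab.
    by apply: inji; apply/esym; apply: (asym (i a, i b)); rewrite /= !GE.
  apply: (separated_determines_topology pc) => a z Laz.
  have [[b _ bz]|iz] := pselect (range i z).
    by rewrite -bz (inj a b)// => L lL; rewrite bz Laz.
  have [az za] := lyapunov_class_at_infinity lc (inj a) iz Laz.
  (* Both pairs lie in [hat_rel i f], hence in its hull, and the hypothesis forces equality. *)
  by apply/esym; apply: (asym (i a, z)); split; exact: sub_G_rel.
- move=> asymf; apply: from_inside => a q aq qa.
  have [[b _ bq]|iq] := pselect (range i q).
    rewrite -bq !GE in aq qa *.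
    case: asymf => [asymf|[_ asymf]].
      suff : (set0 : set (X * X)) (a, b) by [].
      by rewrite -asymf.
    by congr i; apply: (asymf (a, b)).
  case: asymf => [asymf|[pf asymf]].
    (* Going from [i a] to [q] and back gives a loop at [i a], which dynamicity turns into a loop of
       [G_rel f] at [a]. *)
    suff : (set0 : set (X * X)) (a, a) by [].
    by rewrite -asymf; split; rewrite /= -GE; exact: G_rel_trans aq qa.
  (* Here [hat_rel i f] would take [i a] to a point outside X, which +properness rules out. *)
  have [b Lab|||faq _] := @lyapunov_class_at_infinity R X Xh i f lc a q.
  - by have [->//|[ab ba]] := sepin a b Lab; apply/esym; apply: (asymf (a, b)).
  - exact: iq.
  - exact: Gequiv.
  - by case: iq; exact: plus_proper_hat_rel faq.
Qed.
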